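(* Let $R$ be a ring and let $R_0$ be a semi-invariant subring of $R$. If $R$ is semiprimary (resp. right perfect; semiperfect and $\pi_\infty$-regular; semiperfect and $\pi$-regular), then so is $R_0$. In addition, there is $n\in\mathbb{N}$ such that $\mathrm{Jac}(R_0)^n\subseteq\mathrm{Jac}(R)$.
   Context: All rings are unital, ring homomorphisms preserve the unity, and subrings share the unity of the ambient ring. A subring $R_0\subseteq R$ is semi-invariant if there is a ring $S\supseteq R$ and a set $\Sigma$ of ring endomorphisms of $S$ such that $R_0=\{r\in R:\sigma(r)=r\ \text{for all }\sigma\in\Sigma\}$. $\mathrm{Jac}(R)$ is the Jacobson radical. $R$ is semilocal if $R/\mathrm{Jac}(R)$ is semisimple artinian; semiperfect if it is semilocal and idempotents lift modulo $\mathrm{Jac}(R)$; semiprimary if it is semilocal and $\mathrm{Jac}(R)$ is nilpotent; right perfect if it is semilocal and $\mathrm{Jac}(R)$ is right T-nilpotent, i.e. for every sequence $x_1,x_2,\dots\in\mathrm{Jac}(R)$ the sequence $x_1,\,x_2x_1,\,x_3x_2x_1,\dots$ eventually vanishes. $R$ is $\pi$-regular if for every $a\in R$ the chain $aR\supseteq a^2R\supseteq a^3R\supseteq\cdots$ stabilizes (by a theorem of Dischinger this is left-right symmetric); $R$ is $\pi_\infty$-regular if the matrix ring $\mathrm{M}_n(R)$ is $\pi$-regular for all $n\in\mathbb{N}$. *)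

(* Defs.v *)
From HB Require Import structures.
From mathcomp Require Import all_boot all_algebra.
From mathcomp Require Import generic_quotient ring_quotient.
From mathcomp Require Import boolp classical_sets.

Set Implicit Arguments.
Unset Strict Implicit.
Unset Printing Implicit Defensive.

Import GRing.Theory.
Local Open Scope classical_set_scope.
Local Open Scope ring_scope.
Local Open Scope quotient_scope.

(* Rings are noncommutative and possibly trivial (pzRingType); subsets that   *)
(* need not be decidable are classical sets.                                  *)

Section Ideals.
Variable R : pzRingType.
Implicit Types I J M : set R.

Definition right_ideal I : Prop :=
  [/\ I 0, forall x y, I x -> I y -> I (x + y) &
      forall x a, I x -> I (x * a)].

Definition maximal_right_ideal M : Prop :=
  [/\ right_ideal M, M <> setT &
      forall I, right_ideal I -> M `<=` I -> I = M \/ I = setT].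

(* The product of I and J is the set of finite sums of products x * y.        *)
Definition ideal_mul I J : set R :=
  [set x | exists n (a b : 'I_n -> R),
     (forall i, I (a i) /\ J (b i)) /\ x = \sum_i a i * b i].

(* I^0 = R, so that I^1 = I * R = I for a right ideal I.                      *)
Definition ideal_exp I n : set R := iter n (ideal_mul I) setT.

Definition nilpotent_ideal I : Prop := exists n, ideal_exp I n = [set 0].

(* left_prod x n = x_n * ... * x_1 * x_0                                      *)
Fixpoint left_prod (x : nat -> R) (n : nat) : R :=
  if n is n'.+1 then x n * left_prod x n' else x 0%N.

Definition right_T_nilpotent I : Prop :=
  forall x : nat -> R, (forall n, I (x n)) ->
    exists N, forall n, (N <= n)%N -> left_prod x n = 0.

End Ideals.

Definition Jac (R : pzRingType) : set R :=
  \bigcap_(M in @maximal_right_ideal R) M.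
Arguments Jac R : clear implicits.

Section JacIdeal.
Variable R : pzRingType.

Lemma Jac_right_ideal : right_ideal (Jac R).
Proof.
split=> [M [[]]|x y Jx Jy M maxM|x a Jx M maxM] //.
  have [[_ MD _] _ _] := maxM; exact: MD (Jx M maxM) (Jy M maxM).
have [[_ _ MM] _ _] := maxM; exact: MM (Jx M maxM).
Qed.

Lemma Jac_mull (r x : R) : Jac R x -> Jac R (r * x).
Proof.
move=> Jx M [[M0 MD MM] Mneq Mmax]; apply: contrapT => Mrx.
have /Jx : maximal_right_ideal [set s | M (r * s)]; last by [].
split=> [|/(congr1 (@^~ x)) /= Mx|I [I0 ID IM] sMI].
- split=> [|y z|y a] /=; first by rewrite mulr0.
    by rewrite mulrDr; apply: MD.
  by rewrite mulrA; apply: MM.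
- by apply: Mrx; rewrite Mx.
have [sIM|] := pselect (I `<=` [set s | M (r * s)]).
  by left; apply/seteqP.
move=> /existsNP[k /not_implyP[Ik Mrk]]; right.
have I1 : I 1; last by apply/seteqP; split=> // y _; rewrite -[y]mul1r; apply: IM.
have [||NM|NT] := Mmax [set y | exists m t, M m /\ y = m + r * k * t].
- split=> [|_ _ [m [t [Mm ->]]] [n [u [Mn ->]]]|_ a [m [t [Mm ->]]]].
  + by exists 0, 0; rewrite mulr0 addr0.
  + by exists (m + n), (t + u); split; [apply: MD | rewrite mulrDr addrACA].
  + by exists (m * a), (t * a); split; [apply: MM | rewrite mulrDl -mulrA].
- by move=> m Mm; exists m, 0; rewrite mulr0 addr0.
- by case: Mrk; rewrite -NM; exists 0, 1; rewrite mulr1 add0r.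
have [m [t [Mm rE]]] : [set y | exists m t, M m /\ y = m + r * k * t] r.
  by rewrite NT.
rewrite -[1](subrK (k * t)); apply: ID; last exact: IM.
by apply: sMI => /=; rewrite mulrBr mulr1 mulrA {1}rE addrK.
Qed.

Definition Jac_pred : {pred R} := fun x => x \in Jac R.

Lemma Jac_predP x : reflect (Jac R x) (x \in Jac_pred).
Proof. by rewrite unfold_in; apply: (iffP idP); rewrite in_setE. Qed.

Lemma Jac_zmod_closed : zmod_closed Jac_pred.
Proof.
have [J0 JD JM] := Jac_right_ideal.
split=> [|x y /Jac_predP Jx /Jac_predP Jy]; apply/Jac_predP => //.
by rewrite -mulrN1; apply: JD => //; apply: JM.
Qed.

HB.instance Definition _ := GRing.isZmodClosed.Build R Jac_pred Jac_zmod_closed.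

(* ring_quotient gives R / Jac R its additive group structure, but its ring   *)
(* structure on quotients is only for commutative rings.                      *)
Definition quoJac : Type := Quotient.quot Jac_pred.

HB.instance Definition _ := GRing.Zmodule.on quoJac.

Definition to_quoJac (x : R) : quoJac := \pi_(Quotient.quot Jac_pred) x.

Lemma to_quoJac_eq x y : to_quoJac x = to_quoJac y <-> Jac R (x - y).
Proof.
rewrite /to_quoJac; split=> [/eqP|/Jac_predP Jxy].
  by rewrite -Quotient.idealrBE => /Jac_predP.
by apply/eqP; rewrite -Quotient.idealrBE.
Qed.

Lemma to_quoJacK (q : quoJac) : to_quoJac (repr q) = q.
Proof. exact: reprK. Qed.

Lemma to_quoJac_is_zmod_morphism : zmod_morphism to_quoJac.
Proof. by move=> x y; rewrite /to_quoJac !piE. Qed.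

HB.instance Definition _ :=
  GRing.isZmodMorphism.Build R quoJac to_quoJac to_quoJac_is_zmod_morphism.

Definition quoJac_one : quoJac := to_quoJac 1.
Definition quoJac_mul (p q : quoJac) : quoJac := to_quoJac (repr p * repr q).

Lemma to_quoJacM x y :
  to_quoJac (x * y) = quoJac_mul (to_quoJac x) (to_quoJac y).
Proof.
apply/to_quoJac_eq; have [_ JD JM] := Jac_right_ideal.
set x' := repr _; set y' := repr _.
have Jx : Jac R (x - x') by apply/to_quoJac_eq; rewrite to_quoJacK.
have Jy : Jac R (y - y') by apply/to_quoJac_eq; rewrite to_quoJacK.
have -> : x * y - x' * y' = (x - x') * y + x' * (y - y').
  by rewrite mulrBl mulrBr addrA subrK.
by apply: JD; [apply: JM | apply: Jac_mull].
Qed.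

Fact quoJac_mulA : associative quoJac_mul.
Proof.
move=> p q r; rewrite -[p]to_quoJacK -[q]to_quoJacK -[r]to_quoJacK.
by rewrite -!to_quoJacM mulrA.
Qed.

Fact quoJac_mul1 : left_id quoJac_one quoJac_mul.
Proof. by move=> p; rewrite -[p]to_quoJacK -to_quoJacM mul1r. Qed.

Fact quoJac_1mul : right_id quoJac_one quoJac_mul.
Proof. by move=> p; rewrite -[p]to_quoJacK -to_quoJacM mulr1. Qed.

Fact quoJac_mulDl : left_distributive quoJac_mul +%R.
Proof.
move=> p q r; rewrite -[p]to_quoJacK -[q]to_quoJacK -[r]to_quoJacK.
by rewrite -raddfD -!to_quoJacM mulrDl raddfD.
Qed.

Fact quoJac_mulDr : right_distributive quoJac_mul +%R.
Proof.
move=> p q r; rewrite -[p]to_quoJacK -[q]to_quoJacK -[r]to_quoJacK.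
by rewrite -raddfD -!to_quoJacM mulrDr raddfD.
Qed.

HB.instance Definition _ := GRing.Zmodule_isPzRing.Build quoJac
  quoJac_mulA quoJac_mul1 quoJac_1mul quoJac_mulDl quoJac_mulDr.

Lemma to_quoJac_is_monoid_morphism : monoid_morphism to_quoJac.
Proof. by split=> // x y; apply: to_quoJacM. Qed.

HB.instance Definition _ :=
  GRing.isMonoidMorphism.Build R quoJac to_quoJac to_quoJac_is_monoid_morphism.

End JacIdeal.

Section RingClasses.
Variable R : pzRingType.

(* R is semisimple as a right module over itself: every right ideal is a      *)
(* direct summand. This is left-right symmetric by Wedderburn-Artin.          *)
Definition semisimple_ring : Prop :=
  forall I : set R, right_ideal I ->
    exists J : set R, [/\ right_ideal J, I `&` J = [set 0] &
      forall x, exists a b, [/\ I a, J b & x = a + b]].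

Definition right_artinian : Prop :=
  forall I : nat -> set R, (forall n, right_ideal (I n)) ->
    (forall n, I n.+1 `<=` I n) ->
    exists N, forall n, (N <= n)%N -> I n = I N.

Definition semisimple_artinian : Prop := semisimple_ring /\ right_artinian.

Definition pi_regular : Prop :=
  forall a : R, exists N, forall n, (N <= n)%N ->
    range (fun r => a ^+ n * r) = range (fun r => a ^+ N * r).

End RingClasses.

Definition semilocal (R : pzRingType) : Prop := semisimple_artinian (quoJac R).

Definition idempotents_lift_mod_Jac (R : pzRingType) : Prop :=
  forall f : quoJac R, f * f = f -> exists e : R, e * e = e /\ to_quoJac e = f.

Definition semiperfect (R : pzRingType) : Prop :=
  semilocal R /\ idempotents_lift_mod_Jac R.

Definition semiprimary (R : pzRingType) : Prop :=
  semilocal R /\ nilpotent_ideal (Jac R).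

Definition right_perfect (R : pzRingType) : Prop :=
  semilocal R /\ right_T_nilpotent (Jac R).

Definition pi_infty_regular (R : pzRingType) : Prop :=
  forall n, pi_regular 'M[R]_n.

(* The overring S of R is given by an injective unital ring morphism.         *)
Definition semi_invariant (R : pzRingType) (R0 : pred R) : Prop :=
  exists (S : pzRingType) (iota : {rmorphism R -> S})
         (Sigma : set {rmorphism S -> S}),
    injective iota /\
    forall r, R0 r <-> forall sigma, Sigma sigma -> sigma (iota r) = iota r.

(* Main.v *)
(* Endomorphisms of the overring fix everything that is uniquely determined by
   fixed elements; in particular the subring is closed under group inverses
   (commuting d with cdc = c and dcd = d), hence reflects units.

   In all four cases R is semilocal and pi-regular, and then every element of R
   has a power with a group inverse. So the same holds in the subring, which
   makes it pi-regular, with nil radical and liftable idempotents; applying this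
   to matrix rings gives pi_infty-regularity. Semilocality descends along
   unit-reflecting maps into a right artinian ring (Camps and Dicks). Finally,
   the image of the radical of the subring in R / Jac R is a nil semigroup in a
   semisimple ring, so it is nilpotent (Levitzki), and grouping products into
   blocks transfers nilpotence and T-nilpotence of Jac R. *)

Require Import Defs.
From mathcomp Require Import all_boot all_algebra.
From mathcomp Require Import boolp classical_sets.

Set Implicit Arguments.
Unset Strict Implicit.
Unset Printing Implicit Defensive.

Import GRing.Theory.
Local Open Scope classical_set_scope.
Local Open Scope ring_scope.

(** * The Jacobson radical *)

Lemma inverse_unique (R : pzRingType) (a t u : R) :
  a * t = 1 -> t * u = 1 -> a = u.
Proof. by move=> at1 tu1; rewrite -[u]mul1r -at1 -mulrA tu1 mulr1. Qed.

Section Jacobson.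
Variable R : pzRingType.
Implicit Types I K M : set R.

Lemma right_ideal_proper_sub_maximal K :
  right_ideal K -> ~ K 1 -> exists2 M, maximal_right_ideal M & K `<=` M.
Proof.
move=> rK K1.
(* Unions with [K] keep the empty chain of Zorn's lemma harmless. *)
pose P I := right_ideal (I `|` K) /\ ~ (I `|` K) 1.
have [F FP Ftot|M0 [[rM M1] maxM]] := @Zorn_bigcup _ P.
  split=> [|[[I FI I1]|//]]; last by have [_] := FP _ FI; apply; left.
  have [K0 KD KM] := rK.
  split=> [|x y [[I FI Ix]|Kx] [[L FL Ly]|Ky]|x a [[I FI Ix]|Kx]].
  - by right.
  - have [sIL|sLI] := Ftot _ _ FI FL.
      have [[_ LD _] _] := FP _ FL.
      by have [|Kxy] := LD x y (or_introl (sIL _ Ix)) (or_introl Ly);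
        [left; exists L|right].
    have [[_ ID _] _] := FP _ FI.
    by have [|Kxy] := ID x y (or_introl Ix) (or_introl (sLI _ Ly));
      [left; exists I|right].
  - have [[_ ID _] _] := FP _ FI.
    by have [|Kxy] := ID x y (or_introl Ix) (or_intror Ky);
      [left; exists I|right].
  - have [[_ LD _] _] := FP _ FL.
    by have [|Kxy] := LD x y (or_intror Kx) (or_introl Ly);
      [left; exists L|right].
  - by right; apply: KD.
  - have [[_ _ IM] _] := FP _ FI.
    by have [|Kxa] := IM x a (or_introl Ix); [left; exists I|right].
  - by right; apply: KM.
exists (M0 `|` K); last by move=> x; right.
split=> [//|MT|I rI sMI]; first by apply: M1; rewrite MT.
have [I1|I1] := pselect (I 1).
  right; apply/seteqP; split=> // x _; rewrite -[x]mul1r.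
  by have [_ _ IM] := rI; apply: IM.
left; apply: contrapT => neqI; apply: (maxM I); last first.
  have IK : I `|` K = I.
    by apply/seteqP; split=> [x [//|Kx]|x]; [apply: sMI; right|left].
  by rewrite /P IK.
split=> [x M0x|sIM]; first by apply: sMI; left.
by apply: neqI; apply/seteqP; split=> // x /sIM; left.
Qed.

(** If [1 - y * s] generated a proper right ideal, a maximal one above it would contain [y * s] too,
    hence [1]. Conversely, if a maximal [M] misses [y], then [M + y R] is everything, so [M]
    contains a right invertible [1 - y * s]. *)
Lemma JacP y : Jac R y <-> forall s, exists t, (1 - y * s) * t = 1.
Proof.
split=> [Jy s|Hy M [[M0 MD MM] MT maxM]].
  pose K := range (fun t => (1 - y * s) * t).
  have rK : right_ideal K.
    split=> [|_ _ [t _ <-] [u _ <-]|_ a [t _ <-]].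
    - by exists 0; rewrite ?mulr0.
    - by exists (t + u); rewrite ?mulrDr.
    - by exists (t * a); rewrite ?mulrA.
  have [[t _ Ht]|K1] := pselect (K 1); first by exists t.
  have [M maxM sKM] := right_ideal_proper_sub_maximal rK K1.
  have [[M0 MD MM] MT _] := maxM; case: MT.
  have M1 : M 1.
    rewrite -[1](subrK (y * s)); apply: MD; last exact: MM (Jy _ maxM).
    by apply: sKM; exists 1; rewrite ?mulr1.
  by apply/seteqP; split=> // x _; rewrite -[x]mul1r; apply: MM.
apply: contrapT => My; apply: MT.
have [||NM|NT] := maxM [set z | exists m s, M m /\ z = m + y * s].
- split=> [|_ _ [m [t [Mm ->]]] [n [u [Mn ->]]]|_ a [m [t [Mm ->]]]].
  + by exists 0, 0; rewrite mulr0 addr0.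
  + by exists (m + n), (t + u); split; [apply: MD|rewrite mulrDr addrACA].
  + by exists (m * a), (t * a); split; [apply: MM|rewrite mulrDl -mulrA].
- by move=> m Mm; exists m, 0; rewrite mulr0 addr0.
- by case: My; rewrite -NM; exists 0, 1; rewrite mulr1 add0r.
have [m [s [Mm /eqP]]] : [set z | exists m s, M m /\ z = m + y * s] 1.
  by rewrite NT.
rewrite -subr_eq => /eqP mE; have [t Ht] := Hy s.
apply/seteqP; split=> // x _; rewrite -[x]mul1r -Ht mE.
by apply: (MM); apply: MM.
Qed.

Lemma Jac0 : Jac R 0. Proof. by have [] := Jac_right_ideal R. Qed.

Lemma JacD x y : Jac R x -> Jac R y -> Jac R (x + y).
Proof. by have [_ JD _] := Jac_right_ideal R; apply: JD. Qed.

Lemma Jac_mulr x a : Jac R x -> Jac R (x * a).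
Proof. by have [_ _ JM] := Jac_right_ideal R; apply: JM. Qed.

Lemma JacN x : Jac R x -> Jac R (- x).
Proof. by rewrite -mulrN1; apply: Jac_mulr. Qed.

Lemma Jac_sum n (F : 'I_n -> R) :
  (forall i, Jac R (F i)) -> Jac R (\sum_i F i).
Proof. by move=> JF; elim/big_ind: _ => //; [apply: Jac0|apply: JacD]. Qed.

(** The right inverse satisfies [t = 1 + j * t], so it is itself right invertible and hence a
    two-sided inverse. *)
Lemma Jac_unit j : Jac R j -> exists t, (1 - j) * t = 1 /\ t * (1 - j) = 1.
Proof.
move=> Jj; have /JacP/(_ 1)[t] := Jj; rewrite mulr1 => jt1.
have tE : t = 1 - (- (j * t)).
  by apply/eqP; rewrite opprK -subr_eq -{1}[t]mul1r -mulrBl; apply/eqP.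
have [u tu1] : exists u, t * u = 1.
  have /JacP/(_ 1)[u] := JacN (Jac_mulr t Jj).
  by rewrite mulr1 -tE; exists u.
by exists t; split=> //; rewrite (inverse_unique jt1 tu1).
Qed.

Lemma to_quoJac0 (x : R) : to_quoJac x = 0 <-> Jac R x.
Proof. by rewrite -(rmorph0 (@to_quoJac R)) to_quoJac_eq subr0. Qed.

Lemma to_quoJac_unit (u v v' : R) :
  to_quoJac (u * v) = 1 -> to_quoJac (v' * u) = 1 ->
  exists w, u * w = 1 /\ w * u = 1.
Proof.
rewrite -(rmorph1 (@to_quoJac R)) => /esym/to_quoJac_eq Juv.
move=> /esym/to_quoJac_eq Jvu.
have [t [+ _]] := Jac_unit Juv; have [t' [_ +]] := Jac_unit Jvu.
rewrite !subKr mulrA => t'u; rewrite -mulrA => uvt.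
by exists (v * t); split=> //; rewrite -(inverse_unique t'u uvt).
Qed.

End Jacobson.

(** * Chain conditions *)

Lemma dependent_choice (T : Type) (D : set T) (r : T -> T -> Prop) x0 :
  D x0 -> (forall x, D x -> exists2 y, D y & r x y) ->
  exists u : nat -> T, [/\ u 0%N = x0, forall n, D (u n) &
    forall n, r (u n) (u n.+1)].
Proof.
move=> Dx0 Dr.
have /choice[f Hf] x : exists y, D x -> D y /\ r x y.
  by have [/Dr[y Dy ry]|?] := pselect (D x); [exists y|exists x].
have Du n : D (iter n f x0) by elim: n => //= n /Hf[].
by exists (fun n => iter n f x0); split=> // n; have [] := Hf _ (Du n).
Qed.

Section Chains.
Variable A : pzRingType.
Implicit Types I J K W : set A.

Lemma right_ideal_mulr (b : A) : right_ideal (range (fun t => b * t)).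
Proof.
split=> [|_ _ [t _ <-] [u _ <-]|_ a [t _ <-]].
- by exists 0; rewrite ?mulr0.
- by exists (t + u); rewrite ?mulrDr.
- by exists (t * a); rewrite ?mulrA.
Qed.

Lemma right_idealI I J :
  right_ideal I -> right_ideal J -> right_ideal (I `&` J).
Proof.
move=> [I0 ID IM] [J0 JD JM].
split=> [//|x y [Ix Jx] [Iy Jy]|x a [Ix Jx]].
- by split; [apply: ID|apply: JD].
- by split; [apply: IM|apply: JM].
Qed.

Definition ideal_add I J : set A :=
  [set x | exists a b, [/\ I a, J b & x = a + b]].

Lemma right_ideal_add I J :
  right_ideal I -> right_ideal J -> right_ideal (ideal_add I J).
Proof.
move=> [I0 ID IM] [J0 JD JM].
split=> [|_ _ [a [b [Ia Jb ->]]] [c [d [Ic Jd ->]]]|_ a [c [d [Ic Jd ->]]]].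
- by exists 0, 0; rewrite addr0.
- by exists (a + c), (b + d); split; [apply: ID|apply: JD|rewrite addrACA].
- by exists (c * a), (d * a); split; [apply: IM|apply: JM|rewrite mulrDl].
Qed.

Lemma right_idealB I x y : right_ideal I -> I x -> I y -> I (x - y).
Proof.
by move=> [_ ID IM] Ix Iy; rewrite -mulrN1; apply: ID => //; apply: IM.
Qed.

Lemma chain_sub (W : nat -> set A) : (forall n, W n `<=` W n.+1) ->
  forall m n, (m <= n)%N -> W m `<=` W n.
Proof.
move=> sW m n /subnK <-; elim: (n - m)%N => //= k IH; rewrite addSn.
exact: subset_trans (sW _).
Qed.

Lemma chain_sup (W : nat -> set A) : (forall n, W n.+1 `<=` W n) ->
  forall m n, (m <= n)%N -> W n `<=` W m.
Proof.
move=> sW m n /subnK <-; elim: (n - m)%N => //= k IH; rewrite addSn.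
exact: subset_trans (sW _) _.
Qed.

(** Split [1 = a + b] along the union of the chain and a complement: [a] lies in some [W N] and acts
    as a left identity on the whole union. *)
Lemma semisimple_ascending (W : nat -> set A) :
  semisimple_ring A -> (forall n, right_ideal (W n)) ->
  (forall n, W n `<=` W n.+1) ->
  exists N, forall n, (N <= n)%N -> W n = W N.
Proof.
move=> ssA rW sW; pose I := \bigcup_n W n.
have rI : right_ideal I.
  split=> [|x y [m _ Wx] [n _ Wy]|x a [n _ Wx]].
  - by exists 0%N => //; have [] := rW 0%N.
  - exists (maxn m n) => //; have [_ WD _] := rW (maxn m n).
    by apply: WD; [apply: chain_sub Wx|apply: chain_sub Wy] => //;
      rewrite ?leq_maxl ?leq_maxr.
  - by exists n => //; have [_ _ WM] := rW n; apply: WM.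
have [J [rJ IJ0 IJ]] := ssA I rI; have [a [b [[N _ Wa] Jb ab1]]] := IJ 1.
exists N => n leNn; apply/seteqP; split; last exact: chain_sub.
move=> x Wx; suff <- : a * x = x by have [_ _ WM] := rW N; apply: WM.
have Ix : I x by exists n.
apply/eqP; rewrite eq_sym -subr_eq0 -[X in X - _]mul1r -mulrBl ab1 addrC addKr.
suff : (I `&` J) (b * x) by rewrite IJ0 => /= ->.
split; last by have [_ _ JM] := rJ; apply: JM.
have -> : b * x = x - a * x.
  by rewrite -[X in X - _]mul1r -mulrBl ab1 addrC addKr.
by apply: (right_idealB rI) => //; have [_ _ IM] := rI; apply: IM; exists N.
Qed.

Lemma artinian_minimal (F : set (set A)) : right_artinian A ->
  F `<=` @right_ideal A -> F !=set0 ->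
  exists2 I, F I & forall K, F K -> K `<=` I -> K = I.
Proof.
move=> artA rF [I0 FI0]; apply: contrapT => nomin.
have [|u [_ Fu su]] :=
    @dependent_choice _ F (fun I K => K `<=` I /\ K <> I) _ FI0.
  move=> I FI; apply: contrapT => noK; apply: nomin; exists I => // K FK sKI.
  by apply: contrapT => neqKI; apply: noK; exists K.
have [n|n|N HN] := artA u; first exact/rF/Fu.
  by have [] := su n.
by have [_] := su N; apply; apply: HN.
Qed.

(** Complements of the [I n] can be chosen increasing: [J] is enlarged by the intersection of [I n]
    with a complement [K] of [I n.+1]. Once they stabilize, nested ideals with a common complement
    coincide. *)
Lemma semisimple_right_artinian : semisimple_ring A -> right_artinian A.
Proof.
move=> ssA I rI sI.
pose compl n J := [/\ right_ideal J, I n `&` J = [set 0] &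
  forall x, exists a b, [/\ I n a, J b & x = a + b]].
have [J0 cJ0] := ssA _ (rI 0%N).
have [|] := @dependent_choice _ [set p : nat * set A | compl p.1 p.2]
  (fun p q => q.1 = p.1.+1 /\ p.2 `<=` q.2) (0%N, J0) cJ0.
  move=> [n J] /= [rJ IJ0 IJ]; have [K [rK IK0 IK]] := ssA _ (rI n.+1).
  have [Jz JD JM] := rJ; have [Iz ID IM] := rI n.
  have rKI := right_idealI rK (rI n).
  exists (n.+1, ideal_add J (K `&` I n)); last first.
    by split=> // x Jx; exists x, 0; rewrite addr0; have [] := rKI.
  split=> [||x] /=.
  - exact: right_ideal_add.
  - apply/seteqP; split=> [y [Iy [j [k [Jj [Kk Ik] yE]]]]|_ ->] /=; last first.
      by split; [have [] := rI n.+1|exists 0, 0; rewrite addr0; have [] := rKI].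
    have j0 : j = 0.
      suff : (I n `&` J) j by rewrite IJ0.
      split=> //; rewrite -[j](addrK k) -yE.
      by apply: right_idealB => //; apply: sI.
    rewrite yE j0 add0r in Iy *; suff : (I n.+1 `&` K) k by rewrite IK0.
    by [].
  - have [i [j [Ii Jj ->]]] := IJ x; have [i' [k [Ii' Kk iE]]] := IK i.
    exists i', (j + k); split=> //; last by rewrite iE -addrA [k + j]addrC.
    exists j, k; split=> //; split=> //.
    have -> : k = i - i' by rewrite iE addrC addKr.
    by apply: right_idealB => //; apply: sI.
move=> u [u0 cu su].
have u1 n : (u n).1 = n by elim: n => [|n IH]; rewrite ?u0 // (su n).1 IH.
have {}cu n : compl n (u n).2 by rewrite -{1}(u1 n); apply: cu.
have [||N HN] := @semisimple_ascending (fun n => (u n).2) ssA.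
- by move=> n; have [] := cu n.
- by move=> n; have [] := su n.
exists N => n leNn; apply/seteqP; split; first exact: chain_sup.
move=> x Ix; have [_ _ /(_ x)[i [j [Ii Jj xE]]]] := cu n.
suff j0 : j = 0 by rewrite xE j0 addr0.
have [_ IJ0 _] := cu N; suff : (I N `&` (u N).2) j by rewrite IJ0.
split; last by rewrite -(HN n).
have -> : j = x - i by rewrite xE addrC addKr.
by apply: right_idealB => //; apply: chain_sup Ii.
Qed.

(** Multiplying [b ^+ N = b ^+ N.+1 * c] by [a ^+ N] on the left gives [b * c = 1], so [a = c]. *)
Lemma artinian_Dedekind_finite (a b : A) :
  right_artinian A -> a * b = 1 -> b * a = 1.
Proof.
move=> artA ab1.
have [||N HN] := artA (fun n => range (fun t => b ^+ n * t)).
- by move=> n; apply: right_ideal_mulr.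
- by move=> n _ [t _ <-]; exists (b * t) => //; rewrite mulrA -exprSr.
have abN n : a ^+ n * b ^+ n = 1.
  elim: n => [|n IH]; first by rewrite mulr1.
  by rewrite exprSr exprS -mulrA (mulrA a) ab1 mul1r.
have [c _ bc] : range (fun t => b ^+ N.+1 * t) (b ^+ N).
  by rewrite HN //; exists 1; rewrite ?mulr1.
have bc1 : b * c = 1.
  by rewrite -(abN N) -bc exprSr !mulrA abN mul1r.
suff -> : a = c by [].
by rewrite -[a]mulr1 -bc1 mulrA ab1 mul1r.
Qed.

End Chains.



(** * Group inverses and semilocality *)

Definition group_inverse (T : pzRingType) (c d : T) : Prop :=
  [/\ c * d = d * c, c * d * c = c & d * c * d = d].

Lemma group_inverse_unique (T : pzRingType) (c d d' : T) :
  group_inverse c d -> group_inverse c d' -> d = d'.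
Proof.
move=> [cd cdc dcd] [cd' cdc' dcd'].
have e : d * c = d' * c.
  transitivity (d * c * (d' * c)); first by rewrite -{1}cdc' !mulrA.
  by rewrite -cd' -cd !mulrA cdc.
have e' : c * d = c * d' by rewrite cd e cd'.
by rewrite -dcd -mulrA e' mulrA e dcd'.
Qed.

(** The products [y * c] and [c * x] are the same idempotent, and [c * x * x] is the group
    inverse. *)
Lemma group_inverse_of (T : pzRingType) (c x y : T) :
  c = c * c * x -> c = y * c * c -> exists d, group_inverse c d.
Proof.
move=> cx cy; have yc : y * c = c * x by rewrite [in LHS]cx !mulrA -cy.
exists (c * x * x); rewrite /group_inverse.
have -> : c * (c * x * x) = c * x by rewrite !mulrA -cx.
have -> : c * x * x * c = c * x.
  transitivity (y * (c * x) * c); first by rewrite mulrA yc.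
  by rewrite -yc -mulrA -cy.
split=> //; first by rewrite -yc -cy.
transitivity (y * c * (c * x * x)); first by rewrite yc.
by rewrite !mulrA -cy.
Qed.

Lemma group_inverse_morph (T U : pzRingType) (f : {rmorphism T -> U}) c d :
  group_inverse c d -> group_inverse (f c) (f d).
Proof. by move=> [cd cdc dcd]; split; rewrite -!rmorphM ?cdc ?dcd ?cd. Qed.

(* Camps and Dicks: choosing [x] in [I] with [(1 - f x) A] minimal, the right
   ideal generated by [1 - x] is a complement of [I] modulo the radical. *)
Lemma unit_reflecting_semilocal (T A : pzRingType) (f : {rmorphism T -> A}) :
  right_artinian A ->
  (forall u v, f u * v = 1 -> v * f u = 1 -> exists w, u * w = 1) ->
  semilocal T.
Proof.
move=> artA reflf.
suff ss : semisimple_ring (quoJac T).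
  by split=> //; apply: semisimple_right_artinian.
move=> I [I0 ID IM].
pose F := [set K : set A | exists2 x, I (to_quoJac x) &
                           K = range (fun t => (1 - f x) * t)].
have [||_ [x Ix ->] minx] := @artinian_minimal A F artA.
- by move=> _ [x _ ->]; apply: right_ideal_mulr.
- by exists (range (fun t => (1 - f 0) * t)); exists 0 => //; rewrite rmorph0.
pose b := 1 - x.
have Jbr r : I (to_quoJac (b * r)) -> Jac T (b * r).
  move=> Ibr; apply/JacP => s.
  (* The element [1 - (x + b r s b)] equals [b (1 - r s b)], so minimality puts [f b] in the right
     ideal of its image; it also equals [(1 - b r s) b], which makes [f (1 - b r s)] right
     invertible. *)
  have [t _ bt] : range (fun t => (1 - f (x + b * r * s * b)) * t) (f b).
    rewrite (minx (range (fun t => (1 - f (x + b * r * s * b)) * t))).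
    - by exists 1; rewrite ?mulr1 // rmorphB rmorph1.
    - exists (x + b * r * s * b) => //.
      by rewrite rmorphD -!mulrA mulrA rmorphM; apply: ID => //; apply: IM.
    - move=> _ [t _ <-]; exists ((1 - f (r * s * b)) * t) => //.
      rewrite mulrA; congr (_ * t).
      rewrite -(rmorph1 f) -!rmorphB -rmorphM; congr (f _).
      by rewrite mulrBr mulr1 !mulrA opprD addrA.
  pose u := 1 - b * r * s.
  have ubt : f u * (f b * t) = f b.
    rewrite -[RHS]bt mulrA; congr (_ * t).
    rewrite -(rmorph1 f) -!rmorphB -rmorphM; congr (f _).
    by rewrite mulrBl mul1r /b opprD addrA.
  pose v := 1 + f b * t * f (r * s).
  have uv1 : f u * v = 1.
    rewrite mulrDr mulr1 mulrA ubt -!rmorphM -rmorphD mulrA.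
    by rewrite subrK rmorph1.
  exact: (reflf u v uv1 (artinian_Dedekind_finite artA uv1)).
exists (range (fun q => to_quoJac b * q)); split.
- exact: right_ideal_mulr.
- apply/seteqP; split=> [y [Iy [q _ qy]]|_ ->]; last first.
    by split=> //; exists 0; rewrite ?mulr0.
  by move: Iy; rewrite -qy -(to_quoJacK q) -rmorphM => /Jbr/to_quoJac0.
- move=> q; exists (to_quoJac x * q), (to_quoJac b * q).
  split; [exact: IM|by exists q|].
  by rewrite -mulrDl -rmorphD addrC subrK rmorph1 mul1r.
Qed.



(** * Group inverses of powers in pi-regular rings *)

Lemma pi_regularP (T : pzRingType) :
  pi_regular T <-> forall a : T, exists n x, a ^+ n = a ^+ n.+1 * x.
Proof.
split=> [piT a|H a].
  have [N HN] := piT a; exists N.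
  have [x _ ax] : range (fun r => a ^+ N.+1 * r) (a ^+ N).
    by rewrite HN //; exists 1; rewrite ?mulr1.
  by exists x.
have [N [x ax]] := H a; exists N => n /subnK <-.
elim: (n - N)%N => // k IH; rewrite -IH addSn.
apply/seteqP; split=> _ [r _ <-].
  by exists (a * r) => //; rewrite mulrA -exprSr.
exists (x * r) => //; rewrite mulrA; congr (_ * r).
by rewrite -addnS !exprD -mulrA -ax.
Qed.

Lemma pi_regular_power (T : pzRingType) (a x : T) n m :
  a ^+ n = a ^+ n.+1 * x -> (n <= m)%N -> a ^+ m = a ^+ m * a ^+ m * x ^+ m.
Proof.
move=> ax lenm.
have am : a ^+ m = a ^+ m.+1 * x.
  by rewrite -(subnK lenm) -addnS !exprD -mulrA -ax.
suff am_ k : a ^+ m = a ^+ m * a ^+ k * x ^+ k by apply: am_.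
elim: k => [|k IH]; first by rewrite !mulr1.
transitivity (a ^+ k * (a ^+ m.+1 * x) * x ^+ k).
  by rewrite -am -exprD addnC exprD.
by rewrite [x ^+ k.+1]exprS !mulrA -!exprD !addnS addnC.
Qed.

(** Left multiplication by [c * c] kills [x * c - 1] and [x * x * c - x], hence so does [c]. The
    conclusion makes [c * x * x] a group inverse of [c]. *)
Lemma core_inverse (A : pzRingType) (c x : A) :
  c = c * c * x -> (forall t, c * c * t = 0 -> c * t = 0) ->
  c * x * c = c /\ c * x * x * c = c * x.
Proof.
move=> cx Hc; split; apply/eqP; rewrite -subr_eq0.
  have -> : c * x * c - c = c * (x * c - 1) by rewrite mulrBr mulr1 mulrA.
  by apply/eqP/Hc; rewrite mulrBr mulr1 mulrA -cx subrr.
have -> : c * x * x * c - c * x = c * (x * x * c - x) by rewrite mulrBr !mulrA.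
apply/eqP/Hc; rewrite mulrBr !mulrA -cx.
have /Hc : c * c * (x * c - 1) = 0 by rewrite mulrBr mulr1 mulrA -cx subrr.
by rewrite mulrBr mulr1 mulrA.
Qed.

Section LiftAlongNilKernel.
Variables (T A : pzRingType) (f : {rmorphism T -> A}).
Hypothesis kerJ : forall x, f x = 0 -> Jac T x.

Lemma unit_of_morph_eq1 u : f u = 1 -> exists w, u * w = 1 /\ w * u = 1.
Proof.
move=> fu1; have /kerJ/Jac_unit : f (1 - u) = 0.
  by rewrite rmorphB rmorph1 fu1 subrr.
by rewrite subKr.
Qed.

Hypothesis ker_nil : forall x, f x = 0 -> exists n, x ^+ n = 0.

(* With [(p (1 - p))^n = 0], the idempotent is [p^n / (p^n + (1 - p)^n)]; only
   its membership in [p T] matters below. *)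
Lemma lift_idempotent (p : T) : f p * f p = f p ->
  exists q, p * q * (p * q) = p * q /\ f (p * q) = f p.
Proof.
move=> fpp.
have [n nil] : exists n, (p * (1 - p)) ^+ n.+1 = 0.
  have [|n Hn] := ker_nil (x := p * (1 - p)).
    by rewrite rmorphM rmorphB rmorph1 mulrBr mulr1 fpp subrr.
  by exists n; rewrite exprS Hn mulr0.
have fp m : f p ^+ m.+1 = f p by elim: m => // m IH; rewrite exprS IH.
have fp1 m : (1 - f p) ^+ m.+1 = 1 - f p.
  elim: m => // m IH; rewrite exprS IH mulrBr mulr1 mulrBl mul1r fpp subrr.
  by rewrite subr0.
pose u := p ^+ n.+1 + (1 - p) ^+ n.+1.
have fu : f u = 1.
  by rewrite rmorphD !rmorphXn rmorphB rmorph1 fp fp1 addrC subrK.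
have [w [uw wu]] := unit_of_morph_eq1 fu.
have fw : f w = 1 by rewrite -[LHS]mul1r -fu -rmorphM uw rmorph1.
have cp1 : GRing.comm p (1 - p) by apply: commrB; [apply: commr1|].
have cpw : GRing.comm p w.
  have cpu : GRing.comm p u.
    by apply: commrD; apply: commrX.
  rewrite /GRing.comm -[LHS]mul1r -wu -!mulrA (mulrA u) -cpu.
  by rewrite -(mulrA p) uw mulr1.
have cPw m : GRing.comm (p ^+ m) w by apply/commr_sym/commrX/commr_sym.
exists (p ^+ n * w); have -> : p * (p ^+ n * w) = p ^+ n.+1 * w.
  by rewrite mulrA -exprS.
split; last first.
  by rewrite rmorphM fw mulr1 rmorphXn fp.
(* The cross term produced by this rewriting contains [(p * (1 - p)) ^+ n.+1 = 0]. *)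
have -> : p ^+ n.+1 * w * (p ^+ n.+1 * w) =
    p ^+ n.+1 * w * ((u - (1 - p) ^+ n.+1) * w).
  by rewrite addrK.
rewrite mulrBl uw mulrBr mulr1 -[RHS]subr0; congr (_ - _).
rewrite cPw -!mulrA (mulrA (p ^+ _)) -exprMn_comm // nil mul0r mulr0 //.
Qed.

End LiftAlongNilKernel.

Section StronglyPiRegular.
Variables (T A : pzRingType) (f : {rmorphism T -> A}).
Hypothesis kerJ : forall x, f x = 0 -> Jac T x.
Hypothesis annA : forall a : A, exists N, forall n, (N <= n)%N ->
  forall t, a ^+ n * a ^+ n * t = 0 -> a ^+ n * t = 0.
Hypothesis piT : pi_regular T.

(** From [x ^+ n * (1 - x * y) = 0], where [1 - x * y] is invertible. *)
Lemma pi_regular_Jac_nil x : Jac T x -> exists n, x ^+ n = 0.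
Proof.
move=> Jx; have [n [y xy]] := (pi_regularP T).1 piT x; exists n.
have [t [yt _]] := Jac_unit (Jac_mulr y Jx).
rewrite -[LHS]mulr1 -yt mulrA mulrBr mulr1 mulrA -exprSr -xy subrr mul0r //.
Qed.

(* For [c = a^(m+1)] with [c = c^2 x], let [e] in [c T] be an idempotent lifting
   [f (c x)]. Left multiplication by [c] maps [e T] onto [c T], while [e c e] is
   injective on [e T], so [e] is injective on [c T]; hence [e c = c], and a left
   inverse [g] of the corner [e c e] gives [c = g c^2]. *)
Lemma pi_regular_group_inverse (a : T) :
  exists n d, group_inverse (a ^+ n.+1) d.
Proof.
have [n [y ay]] := (pi_regularP T).1 piT a.
have [N HN] := annA (f a).
pose m := (maxn n N); exists m.
set c := a ^+ m.+1; pose x := y ^+ m.+1.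
have cx : c = c * c * x.
  by apply: pi_regular_power ay _; rewrite leqW ?leq_maxl.
have [CXC CXXC] : f c * f x * f c = f c /\ f c * f x * f x * f c = f c * f x.
  apply: core_inverse => [|t]; first by rewrite -!rmorphM -cx.
  by rewrite /c rmorphXn; apply: HN; rewrite leqW ?leq_maxr.
have CCX : f c * f c * f x = f c by rewrite -!rmorphM -cx.
have [||q []] := lift_idempotent kerJ _ (p := c * x).
- by move=> z /kerJ/pi_regular_Jac_nil.
- by rewrite rmorphM mulrA CXC.
move eE : (c * x * q) => e ee; rewrite rmorphM => fe.
(* This element maps to [1] because [f e * f c = f c]; multiplied by [c] on the left it becomes
   [c * e * c * x], whence [c * e * s = c] below. *)
have [s' [js' _]] : exists t, (1 - (1 - e) * c * x) * t = 1 /\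
                           t * (1 - (1 - e) * c * x) = 1.
  apply: (unit_of_morph_eq1 kerJ); rewrite rmorphB !rmorphM rmorphB rmorph1 fe.
  by rewrite mulrBl mul1r CXC subrr mul0r subr0.
pose s := c * x * s'.
have ces : c * e * s = c.
  rewrite -[RHS]mulr1 -js' !mulrA; congr (_ * _).
  by rewrite !mulrBl mul1r mulrBr mulr1 mulrBr !mulrA -cx opprB addrC subrK.
(* As [f g] is the group inverse of [f c], a unit correction [h] makes [h * e * g] a left inverse of
   the corner [e * c * e]. *)
pose g := c * x * x.
have [h [_ hj]] : exists t, (1 - (e - e * g * e * c * e)) * t = 1 /\
                         t * (1 - (e - e * g * e * c * e)) = 1.
  apply: (unit_of_morph_eq1 kerJ); rewrite !rmorphB rmorph1 !rmorphM fe !mulrA.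
  by rewrite CXC !CXXC CXC subrr subr0.
have hce : h * e * g * e * c * e = e.
  transitivity (h * ((1 - (e - e * g * e * c * e)) * e)); last first.
    by rewrite mulrA hj mul1r.
  by rewrite !mulrBl mul1r ee -!mulrA ee subKr.
(* The difference [c - e * c] lies in [c * e * T] and is killed by [e]; the left inverse of the
   corner forces it to vanish. *)
have sE : (1 - e) * c = c * e * s * (1 - x * q * c).
  by rewrite ces mulrBl mulrBr mul1r mulr1 !mulrA eE.
have es0 : e * s * (1 - x * q * c) = 0.
  transitivity (h * e * g * (e * ((1 - e) * c))).
    by rewrite sE -{1}hce !mulrA.
  suff -> : e * ((1 - e) * c) = 0 by rewrite mulr0.
  by rewrite mulrA mulrBr mulr1 ee subrr mul0r.
have ec : e * c = c.
  apply/esym/eqP; rewrite -subr_eq0 -[X in X - _]mul1r -mulrBl sE.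
  by rewrite -(mulrA c e) -(mulrA c) es0 mulr0.
apply: (group_inverse_of (y := h * e * g) cx).
by rewrite -[LHS]ec -{1}hce -(mulrA _ e c) ec -(mulrA (h * e * g) e c) ec.
Qed.

End StronglyPiRegular.



(** * Right perfect rings are pi-regular *)

Lemma semisimple_annihilators_stabilize (A : pzRingType) (a : A) :
  semisimple_ring A ->
  exists N, forall n, (N <= n)%N ->
    forall t, a ^+ n * a ^+ n * t = 0 -> a ^+ n * t = 0.
Proof.
move=> ssA.
have [|n t /= at0|N HN] :=
    semisimple_ascending (W := fun k => [set t | a ^+ k * t = 0]) ssA.
- move=> k; split=> [|x y /= ax ay|x r /= ax]; first exact: mulr0.
    by rewrite mulrDr ax ay addr0.
  by rewrite mulrA ax mul0r.
- by rewrite exprS -mulrA at0 mulr0.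
exists N => n leNn t; rewrite -exprD => at0.
have : [set t | a ^+ (n + n) * t = 0] t by [].
by rewrite HN ?(leq_trans leNn) ?leq_addr // -(HN _ leNn).
Qed.

Lemma left_prod_const (T : pzRingType) (x : T) n :
  left_prod (fun=> x) n = x ^+ n.+1.
Proof. by elim: n => // n IH; rewrite /= IH -exprS. Qed.

Lemma right_artinian_pi_regular (A : pzRingType) :
  right_artinian A -> pi_regular A.
Proof.
move=> artA a; apply: artA => n; first exact: right_ideal_mulr.
by move=> _ [t _ <-]; exists (a * t) => //; rewrite mulrA -exprSr.
Qed.

Lemma conj_expr (T : pzRingType) (u v c : T) n :
  v * u = 1 -> (u * c * v) ^+ n.+1 = u * c ^+ n.+1 * v.
Proof.
move=> vu1; elim: n => // n IH; rewrite exprS IH.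
by rewrite [in RHS]exprS !mulrA -(mulrA (u * c)) vu1 mulr1.
Qed.

Lemma corner_mul (A : pzRingType) (p c y : A) : p * p = p -> c * p = c ->
  p * y = y -> c * y = p -> (c + (1 - p)) * (y + (1 - p)) = 1.
Proof.
move=> pp cp py cy; rewrite mulrDl (mulrDr c) (mulrDr (1 - p)) cy.
rewrite !mulrBr !mulrBl !mulr1 !mul1r pp cp py.
by rewrite !subrr add0r addr0 subr0 addrC subrK.
Qed.

Section BlockElimination.
Variables (T : pzRingType) (e b G : T).
Hypotheses (ee : e * e = e) (eG : e * G = G) (Ge : G * e = G).
Hypotheses (beG : e * b * e * G = e) (Gbe : G * (e * b * e) = e).

(** In the Peirce decomposition for [e], [G] inverts the corner [e * b * e] and [s] is a square-zero
    lower left block. Conjugation by [1 + s] is a block elimination whose new lower left block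
    factors through the old one. *)
Lemma block_step (s := (1 - e) * b * e * G) :
  (1 - s) * (1 + s) = 1 /\
  (1 - e) * ((1 - s) * b * (1 + s)) * e =
    (1 - e - s) * b * (1 - e) * ((1 - e) * b * e) * G.
Proof.
have se : s * e = s by rewrite /s -mulrA Ge.
have ff : (1 - e) * (1 - e) = 1 - e.
  by rewrite mulrBr mulr1 mulrBl mul1r ee subrr subr0.
have fs : (1 - e) * s = s by rewrite /s !mulrA ff.
have ef : e * (1 - e) = 0 by rewrite mulrBr mulr1 ee subrr.
have ss : s * s = 0.
  transitivity (s * e * ((1 - e) * s)); first by rewrite se fs.
  by rewrite mulrA -(mulrA s) ef mulr0 mul0r.
have sbe : s * b * e = (1 - e) * b * e.
  transitivity (s * (e * b * e)); first by rewrite !mulrA se.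
  by rewrite /s -(mulrA _ G) Gbe -(mulrA _ e e) ee.
split; first by rewrite mulrDr mulr1 mulrBl mul1r ss subr0 subrK.
have -> : (1 - e) * ((1 - s) * b * (1 + s)) * e = (1 - e - s) * b * (e + s).
  rewrite !mulrA mulrBr mulr1 fs -[LHS]mulrA; congr (_ * _).
  by rewrite mulrDl mul1r se.
have fz : (1 - e) * ((1 - e) * b * e) * G = s by rewrite !mulrA ff.
rewrite -(mulrA _ (1 - e) (_ * e)) -(mulrA _ _ G) fz mulrDr.
by rewrite [X in X * e]mulrBl mulrBl sbe subrr add0r.
Qed.

(** For block triangular [b] with nilpotent lower right part, [b ^+ k.+1] lies in [e * T], and there
    [b ^+ n * G ^+ n = e] acts as the identity. *)
Lemma block_triangular_expr k : (1 - e) * b * e = 0 ->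
  ((1 - e) * b) ^+ k.+1 = 0 -> b ^+ k.+1 = b ^+ k.+2 * (G ^+ k.+2 * b ^+ k.+1).
Proof.
move=> z0 nil.
have fbf : (1 - e) * b * (1 - e) = (1 - e) * b by rewrite mulrBr mulr1 z0 subr0.
have fb n : ((1 - e) * b) ^+ n.+1 = (1 - e) * b ^+ n.+1.
  by elim: n => // n IH; rewrite exprS IH mulrA fbf -mulrA -exprS.
have eb : e * b ^+ k.+1 = b ^+ k.+1.
  by apply/esym/eqP; rewrite -subr_eq0 -[X in X - _]mul1r -mulrBl -fb nil.
have bG : b * G = e.
  have be : b * e = e * b * e.
    by apply/eqP; rewrite -subr_eq0 -[X in X * e]mul1r -!mulrBl z0.
  by rewrite -eG mulrA be.
have bGn n : b ^+ n.+1 * G ^+ n.+1 = e.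
  elim: n => [|n IH]; first by rewrite !expr1.
  by rewrite [b ^+ n.+2]exprS [G ^+ n.+2]exprSr mulrA -(mulrA b) IH -mulrA eG.
by rewrite mulrA bGn eb.
Qed.

End BlockElimination.

Section RightPerfect.
Variable R : pzRingType.
Hypothesis slR : semilocal R.
Hypothesis tnR : right_T_nilpotent (Jac R).

Local Notation f := (@to_quoJac R).

Lemma T_nilpotent_nil x : Jac R x -> exists n, x ^+ n.+1 = 0.
Proof.
move=> Jx; have [|N HN] := tnR (x := fun=> x); first by [].
by exists N; rewrite -left_prod_const HN.
Qed.

Section Reduction.
Variables (c e Y : R).
Hypotheses (ee : e * e = e) (ec : f e * f c = f c) (ce : f c * f e = f c).
Hypotheses (eY : f e * f Y = f Y) (Ye : f Y * f e = f Y).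
Hypotheses (cY : f c * f Y = f e) (Yc : f Y * f c = f e).

(** Adding [1 - e] turns the corner into an element invertible modulo the radical, hence invertible;
    its inverse is then compressed by [e]. *)
Lemma corner_inverse b : f b = f c ->
  exists G, [/\ e * G = G, G * e = G, e * b * e * G = e & G * (e * b * e) = e].
Proof.
move=> bc.
have fee : f e * f e = f e by rewrite -rmorphM ee.
have fU : f (e * b * e + (1 - e)) = f c + (1 - f e).
  by rewrite rmorphD rmorphB rmorph1 !rmorphM /= bc ec ce.
have fV : f (e * Y * e + (1 - e)) = f Y + (1 - f e).
  by rewrite rmorphD rmorphB rmorph1 !rmorphM /= eY Ye.
have eU : e * (e * b * e + (1 - e)) = e * b * e.
  by rewrite mulrDr mulrBr mulr1 !mulrA ee subrr addr0.
have Ue : (e * b * e + (1 - e)) * e = e * b * e.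
  by rewrite mulrDl mulrBl mul1r -!mulrA ee subrr addr0.
have [||W [UW WU]] := @to_quoJac_unit _ (e * b * e + (1 - e))
    (e * Y * e + (1 - e)) (e * Y * e + (1 - e)).
- by rewrite rmorphM /= fU fV corner_mul.
- by rewrite rmorphM /= fU fV corner_mul.
move: (e * b * e + (1 - e)) eU Ue UW WU => U eU Ue UW WU.
exists (e * W * e); split.
- by rewrite !mulrA ee.
- by rewrite -!mulrA ee.
- transitivity (e * (U * W) * e); last by rewrite UW mulr1.
  by rewrite (mulrA e U) eU !mulrA -(mulrA _ e e) ee.
- transitivity (e * (W * U) * e); last by rewrite WU mulr1.
  by rewrite -(mulrA e (_ * U)) -(mulrA W) Ue !mulrA -(mulrA _ e e) ee.
Qed.

Let conjugate b :=
  f b = f c /\ exists u v, [/\ u * v = 1, v * u = 1 & b = u * c * v].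

(* Conjugating by [1 + s] replaces the lower left corner [z] of [b] by
   [j * z * G] with [j] in the radical, so T-nilpotence eventually kills it. *)
Lemma conjugate_block_triangular : exists2 b, conjugate b & (1 - e) * b * e = 0.
Proof.
have [||b [_ Db step]] := @dependent_choice _ conjugate (fun b b' =>
  exists j G, Jac R j /\ (1 - e) * b' * e = j * ((1 - e) * b * e) * G) c.
- by split=> //; exists 1, 1; split; rewrite ?mul1r ?mulr1.
- move=> b [bc [u [v [uv vu bE]]]].
  have [G [eG Ge beG Gbe]] := corner_inverse bc.
  have [] := block_step ee Ge Gbe; set s := (1 - e) * b * e * G => ss zE.
  have fs : f s = 0.
    rewrite /s !rmorphM rmorphB rmorph1 /= bc [X in X * _ * _]mulrBl mul1r ec.
    by rewrite subrr !mul0r.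
  exists ((1 - s) * b * (1 + s)); last first.
    (* This factor lies in the radical since [f b = f c] and [f c * f e = f c]. *)
    exists ((1 - e - s) * b * (1 - e)), G; split=> //.
    rewrite -mulrA; apply: Jac_mull; apply/to_quoJac0.
    by rewrite rmorphM rmorphB rmorph1 /= bc mulrBr mulr1 ce subrr.
  split.
    rewrite !rmorphM rmorphB rmorphD rmorph1 /= -/s fs.
    by rewrite subr0 addr0 mul1r mulr1.
  have ss' : (1 + s) * (1 - s) = 1.
    rewrite -[RHS]ss; apply: commrB; first exact: commr1.
    by apply/commr_sym/commrD; first exact: commr1.
  exists ((1 - s) * u), (v * (1 + s)); split; last by rewrite bE !mulrA.
    by rewrite mulrA -(mulrA _ u) uv mulr1.
  by rewrite mulrA -(mulrA v) ss' mulr1.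
have /choice[j Hj] := step.
(* Radical factors accumulate on the left, in the order required by right T-nilpotence; the factors
   [G] collect in [H]. *)
have zE n : exists H,
    (1 - e) * b n.+1 * e = left_prod j n * ((1 - e) * b 0%N * e) * H.
  elim: n => [|n [H IH]]; first by have [H [_ ->]] := Hj 0%N; exists H.
  by have [G [_ ->]] := Hj n.+1; exists (H * G); rewrite IH /= !mulrA.
have [|N HN] := tnR (x := j); first by move=> n; have [G []] := Hj n.
by exists (b N.+1) => //; have [H ->] := zE N; rewrite HN // !mul0r.
Qed.

End Reduction.

(** Modulo the radical, a power [c] of [a] is a unit of the corner of an idempotent, which lifts to
    [e]. Some conjugate [b] of [c] is block triangular for [e], with invertible corner and nilpotent
    [(1 - e) * b]. *)
Lemma right_perfect_pi_regular : pi_regular R.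
Proof.
have [ssR artR] := slR; apply/pi_regularP => a.
have [n [y ay]] := (pi_regularP _).1 (right_artinian_pi_regular artR) (f a).
have [N HN] := semisimple_annihilators_stabilize (f a) ssR.
pose m := maxn n N; set c := a ^+ m.+1; pose x := repr y ^+ m.+1.
have CCX : f c = f c * f c * f x.
  rewrite !rmorphXn /= to_quoJacK.
  by apply: pi_regular_power ay _; rewrite leqW ?leq_maxl.
have [t|CXC CXXC] := core_inverse CCX.
  by rewrite /c rmorphXn; apply: HN; rewrite leqW ?leq_maxr.
have [|||q []] := lift_idempotent (f := f) _ _ (p := c * x).
- by move=> z /to_quoJac0.
- by move=> z /to_quoJac0/T_nilpotent_nil[k]; exists k.+1.
- by rewrite rmorphM mulrA CXC.
move: (c * x * q) => e ee; rewrite rmorphM => fe.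
pose g := c * x * x.
have ec : f e * f c = f c by rewrite fe CXC.
have ce : f c * f e = f c by rewrite fe mulrA -CCX.
have eg : f e * f g = f g by rewrite fe !rmorphM !mulrA CXC.
have ge : f g * f e = f g by rewrite fe !rmorphM !mulrA CXXC.
have cg : f c * f g = f e by rewrite fe !rmorphM !mulrA -CCX.
have gc : f g * f c = f e by rewrite fe !rmorphM CXXC.
have [b [bc [u [v [uv vu bE]]]] z0] :=
  conjugate_block_triangular ee ec ce eg ge cg gc.
have [G [eG Ge beG Gbe]] := corner_inverse ee ec ce eg ge cg gc bc.
have [k nil] : exists k, ((1 - e) * b) ^+ k.+1 = 0.
  apply: T_nilpotent_nil; apply/to_quoJac0.
  by rewrite rmorphM rmorphB rmorph1 /= bc fe mulrBl mul1r CXC subrr.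
have bk := block_triangular_expr eG beG z0 nil.
have vbu l : v * b ^+ l.+1 * u = c ^+ l.+1.
  by rewrite bE conj_expr // !mulrA vu mul1r -mulrA vu mulr1.
(* The exponent is that of [c ^+ k.+1]; the leading [a ^+ m] completes one more factor [a] to [c],
   giving [c ^+ k.+2]. *)
exists (m.+1 * k.+1)%N, (a ^+ m * (v * G ^+ k.+2 * b ^+ k.+1 * u)).
rewrite mulrA exprSr -(mulrA _ a) -exprS !exprM -/c -exprSr.
by rewrite -vbu {1}bk -(vbu k.+1) !mulrA -(mulrA _ u) uv mulr1.
Qed.

End RightPerfect.



(** * Nil semigroups in semisimple rings *)

(** The right annihilator of all products of [k] elements of [N], peeling off the rightmost factor
    first. *)
Fixpoint killed_by (T : pzRingType) (N : set T) (k : nat) : set T :=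
  if k is k'.+1 then [set v | forall n, N n -> killed_by N k' (n * v)]
  else [set 0].

Section Killed.
Variables (T : pzRingType) (N : set T).

Lemma right_ideal_killed_by k : right_ideal (killed_by N k).
Proof.
elim: k => [|k [K0 KD KM]].
  by split=> [//|_ _ -> ->|_ a ->] /=; rewrite ?addr0 ?mul0r.
split=> [n _|x y Kx Ky n Nn|x a Kx n Nn]; first by rewrite mulr0.
- by rewrite mulrDr; apply: KD; [apply: Kx|apply: Ky].
- by rewrite mulrA; apply: KM; apply: Kx.
Qed.

Lemma killed_byS k : killed_by N k `<=` killed_by N k.+1.
Proof.
elim: k => [_ -> n _ /=|k IH v Kv n Nn]; first by rewrite mulr0.
by apply: IH; apply: Kv.
Qed.

End Killed.

Section Levitzki.
Variables (A : pzRingType) (N : set A).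
Hypothesis ssA : semisimple_ring A.
Hypothesis artA : right_artinian A.
Hypothesis NM : forall m n, N m -> N n -> N (m * n).
Hypothesis Nnil : forall n, N n -> exists k, n ^+ k = 0.

(* Levitzki: for [U] minimal among the [N]-stable right ideals strictly above
   [W] and [n] in [N] with [n U + W] minimal not in [W], nilpotence of the [n m]
   forces [n N n U] into [W]; the [v] in [U] that [n] and [n N] send into [W]
   then contradict the minimality of [U]. *)
Lemma nil_common_kernel (W : set A) : right_ideal W ->
  (forall n w, N n -> W w -> W (n * w)) -> W <> setT ->
  exists2 u, ~ W u & forall n, N n -> W (n * u).
Proof.
move=> rW NW WT; have [W0 WD WM] := rW.
pose F := [set U : set A | [/\ right_ideal U, W `<=` U, exists2 u, U u & ~ W u &
  forall n u, N n -> U u -> U (n * u)]].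
have [||U [rU sWU [u0 Uu0 Wu0] NU] minU] := artinian_minimal (F := F) artA.
- by move=> U [].
- exists setT; split=> //; apply: contrapT => noW; apply: WT; apply/seteqP.
  by split=> // u _; apply: contrapT => Wu; apply: noW; exists u.
exists u0 => // n0 Nn0; apply: contrapT => Wn0.
have [U0 UD UM] := rU.
pose nU n := ideal_add [set n * u | u in U] W.
pose F2 :=
  [set K | exists n, [/\ N n, exists2 u, U u & ~ W (n * u) & K = nU n]].
have rnU n : right_ideal (nU n).
  apply: right_ideal_add => //.
  split=> [|_ _ [x Ux <-] [y Uy <-]|_ a [x Ux <-]].
  - by exists 0; rewrite ?mulr0.
  - by exists (x + y); [apply: UD|rewrite mulrDr].
  - by exists (x * a); [apply: UM|rewrite mulrA].
have [||_ [n [Nn [u Uu Wnu] ->]] minn] := artinian_minimal (F := F2) artA.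
- by move=> _ [n [_ _ ->]].
- by exists (nU n0), n0; split=> //; exists u0.
have nmn m x : N m -> U x -> W (n * m * n * x).
  move=> Nm Ux; apply: contrapT => Wx; apply: Wnu.
  have nUE : nU (n * m * n) = nU n.
    apply: minn.
      exists (n * m * n); split=> //; last by exists x.
      by apply: NM => //; apply: NM.
    move=> _ [_ [w [[y Uy <-] Ww ->]]]; exists (n * (m * n * y)), w; split=> //.
      by exists (m * n * y) => //; apply: NU => //; apply: NM.
    by rewrite !mulrA.
  (* Modulo [W], every element of [n U] is [n * m] times another one; iterating meets the nilpotence
     of [n * m]. *)
  have step k : exists y w, [/\ U y, W w & n * u = (n * m) ^+ k * (n * y) + w].
    elim: k => [|k [y [w [Uy Ww nuE]]]].
      by exists u, 0; rewrite mul1r addr0.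
    have : nU n (n * y).
      by exists (n * y), 0; rewrite addr0; split=> //; exists y.
    rewrite -nUE => -[_ [w' [[y' Uy' <-] Ww' yE]]].
    exists y', ((n * m) ^+ k * w' + w); split=> //; last first.
      by rewrite nuE yE mulrDr addrA exprSr !mulrA.
    apply: WD => //; elim: k {nuE} => [|k IH]; first by rewrite mul1r.
    by rewrite exprS -mulrA; apply: NW => //; apply: NM.
  have [k nil] := Nnil (NM Nn Nm); have [y [w [_ Ww ->]]] := step k.
  by rewrite nil mul0r add0r.
pose U' := [set v | [/\ U v, W (n * v) & forall m, N m -> W (n * m * v)]].
(* [U'] is an [N]-stable right ideal between [W] and [U]; were it larger than [W], it would be [U]
   and contain [u]. *)
have U'W v : U' v -> W v.
  move=> U'v; apply: contrapT => Wv; apply: Wnu.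
  have U'E : U' = U; last by have [] : U' u by rewrite U'E.
  apply: minU => [|x []] //; split; last 2 first.
  - by exists v.
  - move=> m x Nm [Ux Wx Wmx]; split=> [||m' Nm']; first exact: NU.
      by rewrite mulrA; apply: Wmx.
    by rewrite mulrA -(mulrA n); apply: Wmx; apply: NM.
  - split=> [|x y [Ux Wx Wmx] [Uy Wy Wmy]|x a [Ux Wx Wmx]].
    + by split=> // [|m _]; rewrite mulr0.
    + split=> [||m Nm]; rewrite ?mulrDr; first exact: UD.
        exact: WD.
      by apply: WD; [apply: Wmx|apply: Wmy].
    + split=> [||m Nm]; rewrite ?mulrA; first exact: UM.
        exact: WM.
      by apply: WM; apply: Wmx.
  - move=> x Wx; split; [exact: sWU|exact: NW|].
    by move=> m Nm; apply: NW => //; apply: NM.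
have Wmnu m : N m -> W (m * (n * u)).
  move=> Nm; apply: U'W; split=> [||m' Nm'].
  - by apply: (NU) => //; apply: NU.
  - by rewrite !mulrA; apply: nmn.
  - by rewrite !mulrA -(mulrA n); apply: nmn => //; apply: NM.
apply: Wnu; apply: U'W; split=> [||m Nm]; first exact: NU.
  exact: Wmnu.
by rewrite mulrA; apply: nmn.
Qed.

(** If the chain stopped at a proper ideal, an element outside it that [N] sends into it would
    belong to the next term. *)
Lemma nil_semigroup_nilpotent : exists k, killed_by N k = setT.
Proof.
have [||k Hk] := semisimple_ascending (W := killed_by N) ssA.
- exact: right_ideal_killed_by.
- exact: killed_byS.
exists k; apply: contrapT => WT.
have [|u Wu NWu] := nil_common_kernel (right_ideal_killed_by N k) _ WT.
  by move=> n w Nn /killed_byS; apply.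
by apply: Wu; rewrite -(Hk k.+1).
Qed.

End Levitzki.

(** * Matrix rings *)

(* For a matrix [Z] with a single nonzero row, indexed by [i0], the inverse of
   [1 - Z] is [1 + t Z] where [t] is the inverse of [1 - Z i0 i0]. *)
Lemma Jac_mx (R : pzRingType) n (X : 'M[R]_n) :
  (forall i j, Jac R (X i j)) -> Jac 'M[R]_n X.
Proof.
move=> JX.
pose Y i0 : 'M[R]_n := \matrix_(i, j) if i == i0 then X i j else 0.
have -> : X = \sum_i0 Y i0.
  apply/matrixP => i j; rewrite summxE (bigD1 i) //= mxE eqxx big1 ?addr0 //.
  by move=> k; rewrite mxE eq_sym => /negPf->.
apply: Jac_sum => i0; apply/JacP => S.
move ZE : (Y i0 * S) => Z.
have Z0 i j : i != i0 -> Z i j = 0.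
  move=> /negPf ii0; rewrite -ZE -mulmxE mxE big1 // => k _.
  by rewrite mxE ii0 mul0r.
have JZ j : Jac R (Z i0 j).
  rewrite -ZE -mulmxE mxE; apply: Jac_sum => k; apply: Jac_mulr.
  by rewrite mxE eqxx.
have [t [zt _]] := Jac_unit (JZ i0).
exists (1 + map_mx (fun x => t * x) Z); apply/matrixP => i j.
rewrite mulrDr mulr1 mulrBl mul1r -mulmxE !mxE.
have [->|ii0] := eqVneq i i0; last first.
  rewrite (Z0 i j) // mulr0 big1 ?subrr ?subr0 ?addr0 //.
  by move=> k _; rewrite Z0 // mul0r.
rewrite (bigD1 i0) //= big1 ?addr0 => [|k /Z0 Zk]; last first.
  by rewrite mxE Zk !mulr0.
by rewrite mxE -[X in _ + (X - _)]mul1r -mulrBl mulrA zt mul1r subrK.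
Qed.

(* The right ideals of leading entries of a submodule of [A^n], one for each
   position, determine it within any submodule containing it. *)
Lemma semisimple_vector_chain (A : pzRingType) n (W : nat -> set 'cV[A]_n) :
  semisimple_ring A ->
  (forall k, [/\ W k 0, forall v w, W k v -> W k w -> W k (v + w) &
                 forall v a, W k v -> W k (v *m a%:M)]) ->
  (forall k, W k `<=` W k.+1) ->
  exists N, forall k, (N <= k)%N -> W k `<=` W N.
Proof.
move=> ssA WP sW.
(* Right scalars act on columns as 1 by 1 matrices, [A] being noncommutative. *)
have vsE (v : 'cV[A]_n) (a : A) i : (v *m a%:M) i 0 = v i 0 * a.
  by rewrite mxE big_ord1 mxE eqxx mulr1n.
pose lead (i : 'I_n) k := [set x | exists v, [/\ W k v,
  forall j : 'I_n, (j < i)%N -> v j 0 = 0 & v i 0 = x]].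
have /choice[M HM] (i : 'I_n) :
    exists M, forall k, (M <= k)%N -> lead i k = lead i M.
  apply: semisimple_ascending => // k; last first.
    by move=> x [v [Wv v0 vx]]; exists v; split=> //; apply: sW.
  have [W0 WD WM] := WP k.
  split=> [|_ _ [v [Wv v0 <-]] [w [Ww w0 <-]]|_ a [v [Wv v0 <-]]].
  - by exists 0; split=> // *; rewrite mxE.
  - exists (v + w); split=> [|j ji|]; rewrite ?mxE //; first exact: WD.
    by rewrite v0 // w0 // addr0.
  - exists (v *m a%:M); split=> [|j ji|]; rewrite ?vsE //; first exact: WM.
    by rewrite v0 // mul0r.
pose N := \max_i M i; exists N => k leNk.
have [_ WkD WkM] := WP k; have [WN0 WND _] := WP N.
have sub l : (N <= l)%N -> W N `<=` W l.
  by move=> /subnK <-; elim: (l - N)%N => // m IH; rewrite addSn => v /IH/sW.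
(* Induction on [m], where only the last [m] entries may be nonzero; subtracting some [w] in [W N]
   clears the first of them. *)
suff H m (v : 'cV[A]_n) :
    W k v -> (forall j : 'I_n, (j + m < n)%N -> v j 0 = 0) -> W N v.
  by move=> v Wv; apply: (H n) => // j; rewrite ltnNge leq_addl.
elim: m v => [|m IH] v Wv v0.
  suff -> : v = 0 by [].
  by apply/colP => j; rewrite v0 ?addn0 // mxE.
have [lemn|ltmn] := leqP n m.
  by apply: IH => // j; rewrite ltnNge (leq_trans lemn) ?leq_addl.
have lti : (n - m.+1 < n)%N by rewrite ltn_subrL (leq_ltn_trans _ ltmn).
pose i := Ordinal lti.
have : lead i k (v i 0).
  exists v; split=> // j ji; apply: v0.
  by rewrite addnC -ltn_subRL.
have leMN : (M i <= N)%N by apply: leq_bigmax.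
rewrite HM ?(leq_trans leMN) // -(HM i N) // => -[w [Ww w0 wi]].
have Wvw : W k (v + w *m (-1)%:M).
  by apply: WkD => //; apply: WkM; apply: sub Ww.
rewrite -[v](subrK w); apply: WND => //.
have -> : v - w = v + w *m (-1)%:M.
  by apply/colP => j; rewrite [RHS]mxE vsE mulrN1 !mxE.
apply: IH => // j jm; rewrite mxE vsE mulrN1.
have : (j <= i)%N by rewrite /= leq_subRL // addnC addnS.
rewrite leq_eqVlt => /orP[/eqP ji|ji].
  by rewrite (_ : j = i) ?wi ?subrr //; apply: val_inj.
by rewrite w0 // v0 ?subr0 // addnC -ltn_subRL.
Qed.

Lemma col_mulmx (A : pzRingType) m n p (a : 'M[A]_(m, n)) (t : 'M[A]_(n, p)) j :
  col j (a *m t) = a *m col j t.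
Proof. by rewrite !colE mulmxA. Qed.

(** The kernels of the powers of [a] on columns form an ascending chain of submodules of [A^n]; [t]
    is treated column by column. *)
Lemma semisimple_mx_annihilators_stabilize (A : pzRingType) n (a : 'M[A]_n) :
  semisimple_ring A ->
  exists N, forall k, (N <= k)%N ->
    forall t, a ^+ k * a ^+ k * t = 0 -> a ^+ k * t = 0.
Proof.
move=> ssA.
have [|k v /= av0|N HN] :=
    semisimple_vector_chain (W := fun k => [set v | a ^+ k *m v = 0]) ssA.
- move=> k; split=> [|v w /= av aw|v x /= av]; first exact: mulmx0.
    by rewrite mulmxDr av aw addr0.
  by rewrite mulmxA av mul0mx.
- by rewrite exprS -mulmxE -mulmxA av0 mulmx0.
exists N => k leNk t; rewrite -exprD -!mulmxE => at0.
apply/matrixP => i j.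
have /HN : [set v | a ^+ (k + k) *m v = 0] (col j t).
  by rewrite /= -col_mulmx at0 col0.
move=> /(_ (leq_trans leNk (leq_addr _ _))) /= aN.
have : col j (a ^+ k *m t) = 0.
  by rewrite col_mulmx -(subnK leNk) exprD -mulmxE -mulmxA aN mulmx0.
by move/colP/(_ i); rewrite [LHS]mxE => ->; rewrite !mxE.
Qed.



(** * T-nilpotence and powers of ideals *)

Section LeftProducts.
Variable T : pzRingType.
Implicit Types (x : nat -> T) (I : set T).

Lemma left_prod_cat x p q :
  left_prod x (p + q).+1 =
    left_prod (fun i => x (p.+1 + i)%N) q * left_prod x p.
Proof.
elim: q => [|q IH]; first by rewrite addn0 /= addn0.
rewrite addnS -[LHS]/(x (p + q).+2 * left_prod x (p + q).+1) IH mulrA /=.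
by rewrite addSn addnS.
Qed.

(** As [left_prod x n] has [n.+1] factors, [K.+1] blocks of [m.+1] factors end at index
    [m.+1 * K + m]. *)
Lemma left_prod_blocks x m K :
  left_prod (fun k => left_prod (fun i => x (m.+1 * k + i)%N) m) K =
    left_prod x (m.+1 * K + m).
Proof.
elim: K => [|K IH]; first by rewrite /= muln0.
transitivity (left_prod x (m.+1 * K + m + m).+1); last first.
  by rewrite mulnS !addSn [(m + _)%N]addnC.
rewrite left_prod_cat -IH /=; congr (left_prod _ _ * _); apply/funext => i.
by rewrite mulnS !addSn [(m + _)%N]addnC.
Qed.

Lemma left_prod_eq0 x N n :
  left_prod x N = 0 -> (N <= n)%N -> left_prod x n = 0.
Proof.
move=> xN /subnK <-; elim: (n - N)%N => // k IH.
by rewrite addSn /= IH mulr0.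
Qed.

Lemma left_prod_exp I x n : (forall i, I (x i)) ->
  ideal_exp I n.+1 (left_prod x n).
Proof.
move=> Ix; elim: n => [|n IH].
  exists 1%N, (fun=> x 0%N), (fun=> 1); split=> //.
  by rewrite big_ord1 mulr1.
exists 1%N, (fun=> x n.+1), (fun=> left_prod x n); split=> //.
by rewrite big_ord1.
Qed.

Lemma nilpotent_left_prod I m x : ideal_exp I m = [set 0] ->
  (forall i, I (x i)) -> left_prod x m = 0.
Proof.
case: m => [I0|m Im Ix].
  by have : [set 0] (left_prod x 0) by rewrite -I0.
rewrite /=; have -> : left_prod x m = 0; last by rewrite mulr0.
by have := left_prod_exp m Ix; rewrite Im.
Qed.

Lemma killed_by_left_prod I n v :
  (forall x, (forall i, I (x i)) -> left_prod x n * v = 0) ->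
  killed_by I n.+1 v.
Proof.
elim: n v => [|n IH] v Hv a Ia; first exact: (Hv (fun=> a)).
apply: IH => x Ix.
pose y i := if i is i'.+1 then x i' else a.
have yE m : left_prod y m.+1 = left_prod x m * a.
  by elim: m => // m IHm; rewrite -[LHS]/(x m.+1 * left_prod y m.+1) IHm mulrA.
rewrite mulrA -yE.
by apply: Hv => -[].
Qed.

(** Each factor from [I] lowers the level by one, and sums are absorbed since each level is an
    ideal. At [m = 0] this gives [f y = 0]. *)
Lemma ideal_exp_killed_by (U : pzRingType) (f : {rmorphism T -> U}) I i y m :
  ideal_exp I i y -> killed_by (f @` I) (m + i) = setT ->
  killed_by (f @` I) m (f y).
Proof.
elim: i y m => [|i IH] y m; first by rewrite addn0 => _ ->.
rewrite addnS -addSn => -[n [a [b [Hab ->]]]] K.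
have [K0 KD _] := right_ideal_killed_by (f @` I) m.
rewrite rmorph_sum; elim/big_ind: _ => // j _; rewrite rmorphM.
have [Ia Ib] := Hab j.
by apply: (IH _ m.+1 Ib K); exists (a j).
Qed.

Lemma ideal_exp_left_prod I n :
  (forall x, (forall i, I (x i)) -> left_prod x n = 0) ->
  ideal_exp I n.+1 = [set 0].
Proof.
move=> Hx; apply/seteqP; split=> [y Iy|_ ->]; last first.
  by exists 0%N, (fun=> 0), (fun=> 0); split=> [[]//|]; rewrite big_ord0.
apply: (@ideal_exp_killed_by _ idfun I n.+1 y 0 Iy).
rewrite image_id; apply/seteqP; split=> // v _.
by apply: killed_by_left_prod => x Ix; rewrite Hx // mul0r.
Qed.

End LeftProducts.

Lemma left_prod_morph (T U : pzRingType) (f : {rmorphism T -> U}) x n :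
  left_prod (fun i => f (x i)) n = f (left_prod x n).
Proof. by elim: n => //= n ->; rewrite rmorphM. Qed.

(** * Rings in which every element has a power with a group inverse *)

Section StronglyPiRegularRing.
Variable T : pzRingType.
Hypothesis giT : forall a : T, exists n d, group_inverse (a ^+ n.+1) d.

Lemma group_inverse_pi_regular : pi_regular T.
Proof.
apply/pi_regularP => a; have [n [d [cd cdc _]]] := giT a.
exists n.+1, (a ^+ n * d).
transitivity (a ^+ n.+1 * a ^+ n.+1 * d); first by rewrite -mulrA cd mulrA cdc.
by rewrite mulrA -!exprD addnS addSn.
Qed.

(** For a power [c] of a representative of [q], with group inverse [d], the idempotent [c * d] lifts
    [q]: since [c] maps to [q], both [c * d] and [c * (c * d) = c] have image [q]. *)
Lemma group_inverse_lift_idempotents : idempotents_lift_mod_Jac T.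
Proof.
move=> q qq; have [n [d [cd cdc _]]] := giT (repr q).
exists (repr q ^+ n.+1 * d); split; first by rewrite mulrA cdc.
have fq m : q ^+ m.+1 = q by elim: m => // m IH; rewrite exprS IH.
have : to_quoJac (repr q ^+ n.+1 * (repr q ^+ n.+1 * d)) =
       to_quoJac (repr q ^+ n.+1).
  by rewrite cd mulrA cdc.
by rewrite !rmorphM !rmorphXn /= to_quoJacK !fq mulrA qq.
Qed.

End StronglyPiRegularRing.

Lemma semilocal_group_inverse (R : pzRingType) : semilocal R -> pi_regular R ->
  forall a : R, exists n d, group_inverse (a ^+ n.+1) d.
Proof.
move=> [ssR _] piR; apply: (pi_regular_group_inverse (f := @to_quoJac R)) piR.
  by move=> x /to_quoJac0.
by move=> a; apply: semisimple_annihilators_stabilize.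
Qed.

Lemma semilocal_mx_group_inverse (R : pzRingType) n :
  semilocal R -> pi_regular 'M[R]_n ->
  forall a : 'M[R]_n, exists m d, group_inverse (a ^+ m.+1) d.
Proof.
move=> [ssR _] piR.
apply: (pi_regular_group_inverse (f := map_mx (@to_quoJac R))) piR.
  move=> X X0; apply: Jac_mx => i j; apply/to_quoJac0.
  by move/matrixP/(_ i j): X0; rewrite !mxE.
by move=> a; apply: semisimple_mx_annihilators_stabilize.
Qed.

Lemma pi_infty_regular_pi_regular (R : pzRingType) :
  pi_infty_regular R -> pi_regular R.
Proof.
move=> piR; apply/pi_regularP => a.
have [n [X aX]] := (pi_regularP _).1 (piR 1%N) a%:M; exists n, (X 0 0).
have aE m : (a%:M : 'M_1) ^+ m = (a ^+ m)%:M by rewrite -rmorphXn.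
move/matrixP/(_ 0 0): aX; rewrite !aE -mulmxE mxE eqxx mulr1n => ->.
by rewrite mxE big_ord1 mxE eqxx mulr1n.
Qed.

(** * Descent to the subring *)

Section GroupInverseClosed.
Variables (T0 T : pzRingType) (f : {rmorphism T0 -> T}).
Hypothesis f_inj : injective f.
Hypothesis f_gi : forall c d, group_inverse (f c) d -> exists d0, f d0 = d.

Lemma group_inverse_descends :
  (forall a : T, exists n d, group_inverse (a ^+ n.+1) d) ->
  forall a : T0, exists n d, group_inverse (a ^+ n.+1) d.
Proof.
move=> giT a; have [n [d]] := giT (f a); rewrite -rmorphXn => gi.
have [d0 dE] := f_gi gi; move: gi; rewrite -dE => -[cd cdc dcd].
by exists n, d0; split; apply: f_inj; rewrite !rmorphM.
Qed.

(** The inverse of a unit is a group inverse, so [f] reflects units, as does reduction modulo the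
    radical. *)
Lemma semilocal_descends : semilocal T -> semilocal T0.
Proof.
move=> [_ artT].
apply: (unit_reflecting_semilocal (f := @to_quoJac T \o f) artT) => u v.
rewrite /= -(to_quoJacK v) -!rmorphM => uv1 vu1.
have [w [uw wu]] := to_quoJac_unit uv1 vu1.
have [|w0 wE] := @f_gi u w; first by split; rewrite ?uw ?wu ?mul1r.
by exists w0; apply: f_inj; rewrite rmorphM rmorph1 wE.
Qed.

Lemma Jac_exp_sub : semilocal T -> pi_regular T -> exists n,
  forall y, ideal_exp (Jac T0) n.+1 y -> Jac T (f y).
Proof.
move=> slT piT; have [ssT artT] := slT.
have piT0 : pi_regular T0.
  exact/group_inverse_pi_regular/group_inverse_descends/semilocal_group_inverse.
pose F : {rmorphism T0 -> quoJac T} := @to_quoJac T \o f.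
have [||k Hk] := @nil_semigroup_nilpotent _ (F @` Jac T0) ssT artT.
- move=> _ _ [x Jx <-] [y Jy <-]; exists (x * y); rewrite ?rmorphM //.
  exact: Jac_mulr.
- move=> _ [x Jx <-]; have [k xk] := pi_regular_Jac_nil piT0 Jx.
  by exists k; rewrite -rmorphXn xk rmorph0.
exists k => y Jy; apply/to_quoJac0.
apply: (@ideal_exp_killed_by _ _ F _ k.+1 y 0 Jy).
by apply/seteqP; split=> // v _; apply: killed_byS; rewrite Hk.
Qed.

End GroupInverseClosed.

Section SemiInvariant.
Variables (R : pzRingType) (P : pred R) (R0 : subPzRingType P).
Hypothesis siP : semi_invariant P.

Lemma semi_invariant_group_inverse (c : R0) d :
  group_inverse (val c) d -> exists d0 : R0, val d0 = d.
Proof.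
have [S [iota [Sigma [iota_inj PE]]]] := siP.
move=> gi; have Pd : P d.
  apply/PE => sigma Ss; have /PE/(_ sigma Ss) cE := valP c.
  have gi1 := group_inverse_morph iota gi.
  have := group_inverse_morph sigma gi1; rewrite cE.
  by move/group_inverse_unique; apply.
by exists (Sub d Pd); rewrite SubK.
Qed.

(** Endomorphisms act entrywise on matrices over [S], so uniqueness of the group inverse there fixes
    every entry of [d]. *)
Lemma semi_invariant_mx_group_inverse n (c : 'M[R0]_n) d :
  group_inverse (map_mx val c) d -> exists d0 : 'M[R0]_n, map_mx val d0 = d.
Proof.
have [S [iota [Sigma [iota_inj PE]]]] := siP.
move=> gi; have Pd i j : P (d i j).
  apply/PE => sigma Ss.
  have gi1 := group_inverse_morph (map_mx iota) gi.
  have sE : map_mx sigma (map_mx iota (map_mx val c)) =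
            map_mx iota (map_mx val c).
    apply/matrixP => k l; rewrite !mxE.
    by have /PE/(_ sigma Ss) := valP (c k l).
  have : group_inverse (map_mx iota (map_mx val c))
                       (map_mx sigma (map_mx iota d)).
    by rewrite -{1}sE; apply: (group_inverse_morph (map_mx sigma) gi1).
  move/group_inverse_unique/(_ gi1)/matrixP/(_ i j).
  by rewrite !mxE.
exists (\matrix_(i, j) Sub (d i j) (Pd i j)).
by apply/matrixP => i j; rewrite !mxE SubK.
Qed.

End SemiInvariant.

Theorem theorem4p6 (R : pzRingType) (P : pred R) (R0 : subPzRingType P)
    (semi_invariant_R0 : semi_invariant P) :
  [/\ semiprimary R -> semiprimary R0,
      right_perfect R -> right_perfect R0,
      semiperfect R /\ pi_infty_regular R ->
        semiperfect R0 /\ pi_infty_regular R0,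
      semiperfect R /\ pi_regular R -> semiperfect R0 /\ pi_regular R0 &
      [\/ semiprimary R, right_perfect R,
          semiperfect R /\ pi_infty_regular R |
          semiperfect R /\ pi_regular R] ->
        exists n : nat, (0 < n)%N /\
          val @` ideal_exp (Jac R0) n `<=` Jac R].
Proof.
pose v : {rmorphism R0 -> R} := val.
have v_inj : injective v := val_inj.
have v_gi := semi_invariant_group_inverse semi_invariant_R0 : forall (c : R0) d,
  group_inverse (v c) d -> exists d0, v d0 = d.
have sl : semilocal R -> semilocal R0 := semilocal_descends v_inj v_gi.
have gi slR piR :=
  group_inverse_descends v_inj v_gi (semilocal_group_inverse slR piR).
have JJ := Jac_exp_sub v_inj v_gi.
have sp_rp : semiprimary R -> right_perfect R.
  move=> [slR [m Jm]]; split=> // x Jx; exists m => n.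
  by apply: left_prod_eq0; apply: nilpotent_left_prod Jm Jx.
have rp_pi : right_perfect R -> semilocal R /\ pi_regular R.
  by move=> [slR tnR]; split=> //; apply: right_perfect_pi_regular.
(* Products of [n.+1] consecutive terms fall into [Jac R], where nilpotence or T-nilpotence applies
   to the sequence of blocks. *)
have block n (x : nat -> R0) M :
    (forall y, ideal_exp (Jac R0) n.+1 y -> Jac R (v y)) ->
    (forall i, Jac R0 (x i)) ->
    let y k := left_prod (fun i => x (n.+1 * k + i)%N) n in
    (forall k, Jac R (v (y k))) /\
    (left_prod (fun k => v (y k)) M = 0 -> left_prod x (n.+1 * M + n) = 0).
  move=> Jn Jx y; split=> [k|]; first last.
    by rewrite left_prod_morph => yM; apply: v_inj;
      rewrite -left_prod_blocks yM rmorph0.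
  by apply: Jn; apply: left_prod_exp => i; apply: Jx.
split.
- move=> spR; have [slR piR] := rp_pi (sp_rp spR).
  have [n Jn] := JJ slR piR; have [_ [m Jm]] := spR.
  split; first exact: sl.
  (* This counts the factors of [m.+1] blocks of length [n.+1]. *)
  exists (n.+1 * m + n).+1; apply: ideal_exp_left_prod => x Jx.
  have [Jy] := block n x m Jn Jx; apply.
  exact: nilpotent_left_prod Jm Jy.
- move=> rpR; have [slR piR] := rp_pi rpR.
  have [n Jn] := JJ slR piR; have [_ tnR] := rpR.
  split; first exact: sl.
  (* The [0%N] is a dummy: the number [M] of blocks is only known once T-nilpotence is applied to
     them. *)
  move=> x Jx; have [Jy _] := block n x 0%N Jn Jx.
  have [M HM] := tnR _ Jy; exists (n.+1 * M + n)%N => k.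
  apply: left_prod_eq0; have [_] := block n x M Jn Jx; apply.
  exact: HM.
- move=> [[slR _] piiR]; have piR := pi_infty_regular_pi_regular piiR.
  split; first by split; [exact: sl|exact/group_inverse_lift_idempotents/gi].
  move=> n; apply: group_inverse_pi_regular.
  apply: (@group_inverse_descends _ _ (map_mx v)).
  + move=> X Y XY; apply/matrixP => i j; apply: v_inj.
    by move/matrixP/(_ i j): XY; rewrite !mxE.
  + exact: semi_invariant_mx_group_inverse.
  + exact: semilocal_mx_group_inverse.
- move=> [[slR _] piR]; split; last exact/group_inverse_pi_regular/gi.
  by split; [exact: sl|exact/group_inverse_lift_idempotents/gi].
- move=> H; have [slR piR] : semilocal R /\ pi_regular R.
    case: H => [/sp_rp/rp_pi //|/rp_pi //||].
      by move=> [[slR _] /pi_infty_regular_pi_regular].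
    by move=> [[slR _]].
  have [n Jn] := JJ slR piR; exists n.+1; split=> // _ [y Jy <-].
  exact: Jn.
Qed.
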